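(* Let $A\in\mathbb{R}^{n\times n}$ be invertible, $D\in\mathbb{R}^{n\times n}$ with $D\ne0$, $c\in\mathbb{R}^n$, $r_1,r_2\in\mathbb{R}_+$, $$E^2=\{x\in\mathbb{R}^n:\|A(x-c)\|_2^2\le r_1\},\qquad F=\{x\in\mathbb{R}^n:\|D(x-c)\|_2^2\le r_2\}.$$ Let $v_1,\dots,v_n\in\mathbb{R}^n$ and $\alpha_1,\dots,\alpha_n\in\mathbb{R}$ be an eigenvalue decomposition $$A^{-T}D^TDA^{-1}=\sum_{i=1}^n\alpha_iv_iv_i^T$$ with $\|v_i\|_2=1$ for all $i\in[n]$, $v_i^Tv_j=0$ for all $i\ne j$, and $\alpha_n\ge\alpha_i$ for all $i\in[n]$. Let $$R=\sum_{i=1}^{n-1}(1-\alpha_i/\alpha_n)v_iv_i^T,\quad N=A^TRA,\quad a=-2A^TRAc,\quad f=c^TA^TRAc+r_2/\alpha_n-r_1.$$ Then $$\mathrm{conv}\bigl(E^2\setminus \mathrm{int}(F)\bigr)=\bigl\{x\in\mathbb{R}^n:\|A(x-c)\|_2^2\le r_1,\ \ x^TNx+a^Tx+f\le0\bigr\}.$$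
   Context: $[n]=\{1,\dots,n\}$, $\mathbb{R}_+$ is the set of nonnegative reals, and $A^{-T}=(A^{-1})^T$. $E^2$ is just a name for the set. $\mathrm{int}$ is the topological interior and $\mathrm{conv}$ the convex hull. *)

(* Defs.v *)
From HB Require Import structures.
From mathcomp Require Import all_boot all_order all_algebra.
From mathcomp Require Import all_classical all_reals all_analysis.

Set Implicit Arguments.
Unset Strict Implicit.
Unset Printing Implicit Defensive.

Import Order.TTheory GRing.Theory Num.Theory.
Import numFieldNormedType.Exports.

Local Open Scope classical_set_scope.
Local Open Scope ring_scope.

(* The library norm `|x| on matrices is the sup norm; it induces the same
   topology on 'cV[R]_n as the Euclidean norm below. *)
Definition norm2 (R : realType) (n : nat) (x : 'cV[R]_n) : R :=
  Num.sqrt (\sum_(i < n) x i 0 ^+ 2).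

Definition norm2_sublevel (R : realType) (n : nat) (B : 'M[R]_n) (c : 'cV[R]_n)
    (r : R) : set 'cV[R]_n :=
  [set x | norm2 (B *m (x - c)) ^+ 2 <= r].

Definition convex_hull (R : realType) (n : nat) (S : set 'cV[R]_n) :
    set 'cV[R]_n :=
  smallest [set C : set 'cV[R]_n | convex_set C] S.

(* Main.v *)
Require Import Defs.
From HB Require Import structures.
From mathcomp Require Import all_boot all_order all_algebra.
From mathcomp Require Import ring lra.
From mathcomp Require Import all_classical all_reals all_analysis.

Set Implicit Arguments.
Unset Strict Implicit.
Unset Printing Implicit Defensive.

Import Order.TTheory GRing.Theory Num.Theory.
Import numFieldNormedType.Exports.

Local Open Scope classical_set_scope.
Local Open Scope ring_scope.

(* In the coordinates z_i = v_i^T A (x - c) the ball E^2 is |z|^2 <= r1, and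
   int F is q(z) < r2 with q(z) = sum_i alpha_i z_i^2: this holds even for
   r2 = 0, because q strictly increases along one of the directions +-v_n,
   alpha_n being positive.  The quadratic constraint reads
   |z|^2 - q(z) / alpha_n <= r1 - r2 / alpha_n; its left-hand side does not
   involve z_n and is convex since alpha_i <= alpha_n, whence one inclusion.
   Conversely, a point satisfying both constraints lies on the segment in
   direction v_n whose end points have |z|^2 = r1; there the constraint says
   exactly that q(z) >= r2, so both end points are in E^2 \ int F. *)

Lemma norm2_sqr (R : realType) n (x : 'cV[R]_n) :
  norm2 x ^+ 2 = (x^T *m x) 0 0.
Proof.
rewrite sqr_sqrtr ?sumr_ge0 // => [|i _]; last exact: sqr_ge0.
by rewrite mxE; apply: eq_bigr => i _; rewrite mxE expr2.
Qed.

Lemma norm2_sqr_le0 (R : realType) n (x : 'cV[R]_n) :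
  norm2 x ^+ 2 <= 0 -> x = 0.
Proof.
have x2_ge0 i : 0 <= x i 0 ^+ 2 by exact: sqr_ge0.
rewrite sqr_sqrtr ?sumr_ge0 // le_eqVlt ltNge sumr_ge0 // orbF psumr_eq0 //.
move=> /allP x2_eq0; apply/colP => i; rewrite mxE; apply/eqP.
by rewrite -sqrf_eq0; apply: (x2_eq0 i); rewrite mem_index_enum.
Qed.

Lemma continuous_sum (R : realType) (T : topologicalType) (I : finType)
    (F : I -> T -> R) :
  (forall i, continuous (F i)) -> continuous (fun x => \sum_i F i x).
Proof.
by move=> F_cont; apply: (@continuous_big R _ +%R 0 xpredT (@add_continuous R)).
Qed.

(* Over an abstract space [T]: with [T := 'cV[R]_n] unification unfolds the
   neighbourhood filter of matrices and no longer finds its [Filter] instance. *)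
Lemma continuous_sum_sqr_affine (R : realType) (T : topologicalType)
    (I J : finType) (B : I -> J -> R) (c : J -> R) (F : J -> T -> R) :
  (forall j, continuous (F j)) ->
  continuous (fun x => \sum_i (\sum_j B i j * (F j x - c j)) ^+ 2).
Proof.
move=> F_cont; apply: continuous_sum => i x; under eq_fun do rewrite expr2.
have cont_row : continuous (fun x => \sum_j B i j * (F j x - c j)).
  apply: continuous_sum => j y; apply: cvgM; first exact: cvg_cst.
  by apply: cvgB; [exact: F_cont | exact: cvg_cst].
by apply: cvgM; exact: cont_row.
Qed.

Lemma continuous_norm2_sqr (R : realType) n (B : 'M[R]_n) (c : 'cV[R]_n) :
  continuous (fun x : 'cV[R]_n => norm2 (B *m (x - c)) ^+ 2).
Proof.
have -> : (fun x => norm2 (B *m (x - c)) ^+ 2) =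
    (fun x : 'cV[R]_n => \sum_i (\sum_j B i j * (x j 0 - c j 0)) ^+ 2).
  apply/funext => x; rewrite norm2_sqr mxE; apply: eq_bigr => i _.
  by rewrite !mxE expr2; congr (_ * _); apply: eq_bigr => j _; rewrite !mxE.
apply: (@continuous_sum_sqr_affine _ 'cV[R]_n _ _ B (c^~ 0) (fun j x => x j 0)).
by move=> j; exact: (@coord_continuous R n 1 j 0).
Qed.

(** Any neighbourhood of [x] contained in the sublevel set contains [w t] for some small [t > 0],
    and there [g x < g (w t) <= r]. The other inclusion is continuity of [g]. *)
Lemma interior_sublevel (R : realType) (T : topologicalType) (g : T -> R)
    (r : R) :
  continuous g ->
  (forall x, exists2 w : R -> T, w t @[t --> 0] --> x &
                                 forall t, 0 < t -> g x < g (w t)) ->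
  interior [set x | g x <= r] = [set x | g x < r].
Proof.
move=> g_cont g_incr; apply/seteqP; split => x /=; last first.
  move=> gx; have gx_near : \forall y \near x, g y < r.
    by exact: cvgr_lt (g_cont x) _ gx.
  by apply: (filterS _ gx_near) => y /ltW.
have [w w_cvg gw] := g_incr x.
move=> /w_cvg /nbhs_ballP [e /= e0 He].
have e2 : 0 < e / 2 by rewrite divr_gt0.
apply: lt_le_trans (gw _ e2) (He _ _).
by rewrite /ball /= sub0r normrN gtr0_norm // ltr_pdivrMr // ltr_pMr // ltr1n.
Qed.

Lemma cvg_line (R : realType) n (x w : 'cV[R]_n.+1) :
  (x + t *: w) @[t --> (0 : R)] --> x.
Proof.
rewrite -[X in _ --> X]addr0 -[X in x + X](scale0r w).
by apply: cvgD; [exact: cvg_cst | apply: cvgZr_tmp; exact: cvg_id].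
Qed.

(** The weights are [t / (t - s)] and [- s / (t - s)]. They degenerate when [s = t], but then both
    vanish and [x] itself lies in [S]. *)
Lemma convex_hull_segment (R : realType) n (S : set 'cV[R]_n) x w (s t : R) :
  s <= 0 -> 0 <= t -> S (x + s *: w) -> S (x + t *: w) -> convex_hull S x.
Proof.
move=> s0 t0 Ss St C [/= C_conv SC].
have [st|st] := eqVneq s t.
  have s_eq0 : s = 0 by lra.
  by move: (SC _ Ss); rewrite s_eq0 scale0r addr0.
have st0 : 0 < t - s by rewrite subr_gt0 lt_neqAle st (le_trans s0).
have l0 : 0 <= t / (t - s) by rewrite divr_ge0 // ltW.
have l1 : t / (t - s) <= 1 by rewrite ler_pdivrMr // mul1r lerDl oppr_ge0.
have := C_conv _ _ (Itv01 l0 l1) (mem_set (SC _ Ss)) (mem_set (SC _ St)).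
move=> /set_mem; rewrite [X in C X](_ : _ = x) //=.
rewrite [LHS](_ : _ = (t / (t - s)) *: (x + s *: w)
                      + (1 - t / (t - s)) *: (x + t *: w)) //.
apply/matrixP => i j; rewrite !mxE; field; exact: lt0r_neq0.
Qed.

Lemma convex_sublevel_sum_sqr (R : realType) n (I : finType) (P : pred I)
    (b : I -> R) (l : I -> 'cV[R]_n -> R) (r : R) :
  (forall i, P i -> 0 <= b i) ->
  (forall i k x y, l i (k *: x + (1 - k) *: y) = k * l i x + (1 - k) * l i y) ->
  convex_set [set x : 'cV[R]_n | \sum_(i | P i) b i * l i x ^+ 2 <= r].
Proof.
move=> b_ge0 l_affine x y k /set_mem /= xS /set_mem /= yS; apply/mem_set => /=.
have k0 : 0 <= k%:num by [].
have k1 : k%:num <= 1 by [].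
change (\sum_(i | P i) b i * l i (k%:num *: x + (1 - k%:num) *: y) ^+ 2 <= r).
under eq_bigr => i _ do rewrite l_affine.
move: (k%:num) k0 k1 => q q0 q1.
have le_term i : P i -> b i * (q * l i x + (1 - q) * l i y) ^+ 2 <=
    q * (b i * l i x ^+ 2) + (1 - q) * (b i * l i y ^+ 2).
  move=> /b_ge0 bi0; rewrite -subr_ge0.
  (* The convexity gap of a square is exactly [q * (1 - q)] times the squared difference. *)
  rewrite [X in 0 <= X](_ : _ = b i * (q * (1 - q)) * (l i x - l i y) ^+ 2).
    by apply: mulr_ge0; [rewrite !mulr_ge0 ?subr_ge0 | exact: sqr_ge0].
  by ring.
apply: le_trans (ler_sum _ le_term) _; rewrite big_split /= -!mulr_sumr.
rewrite [leRHS](_ : _ = q * r + (1 - q) * r); last by ring.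
by rewrite lerD // ler_wpM2l // subr_ge0.
Qed.

(** Taken at [y = A (x - c)] with weights [1], [alpha i] and [1 - alpha i / alpha_n], this
    diagonalises all three quadratic functions at once. *)
Lemma quadform_spectral (R : realType) n (I : finType) (P : pred I) (b : I -> R)
    (v : I -> 'cV[R]_n) (y : 'cV[R]_n) :
  (y^T *m (\sum_(i | P i) b i *: (v i *m (v i)^T)) *m y) 0 0 =
  \sum_(i | P i) b i * ((v i)^T *m y) 0 0 ^+ 2.
Proof.
rewrite mulmx_sumr mulmx_suml summxE; apply: eq_bigr => i _.
rewrite -scalemxAr -scalemxAl mxE; congr (_ * _).
have -> : y^T *m (v i *m (v i)^T) *m y = ((v i)^T *m y)^T *m ((v i)^T *m y).
  by rewrite trmx_mul trmxK !mulmxA.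
by rewrite [LHS]mxE big_ord1 mxE.
Qed.

(** The square matrix [V] with columns [v j] satisfies [V^T V = 1], hence also [V V^T = 1], which is
    the claimed sum. *)
Lemma orthonormal_resolution (R : realType) n (v : 'I_n -> 'cV[R]_n) :
  (forall i, norm2 (v i) = 1) -> (forall i j, i != j -> (v i)^T *m v j = 0) ->
  \sum_i v i *m (v i)^T = 1%:M.
Proof.
move=> v_norm1 v_orth; pose V : 'M[R]_n := \matrix_(i, j) v j i 0.
have VTV : V^T *m V = 1%:M.
  apply/matrixP => i j; rewrite !mxE.
  have -> : \sum_k V^T i k * V k j = ((v i)^T *m v j) 0 0.
    by rewrite mxE; apply: eq_bigr => k _; rewrite !mxE.
  have [<-|ij] := eqVneq i j; last by rewrite v_orth // mxE.
  by rewrite -norm2_sqr v_norm1 expr1n.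
rewrite -(mulmx1C VTV); apply/matrixP => i j; rewrite summxE mxE.
by apply: eq_bigr => k _; rewrite !mxE big_ord1 !mxE.
Qed.

(** Symmetry of [N] merges the two cross terms. This explains the formulas for [a] and [f]: they
    come from centring the form at [c]. *)
Lemma quadform_shift (R : realType) n (N : 'M[R]_n) (c x : 'cV[R]_n) :
  N^T = N ->
  ((x - c)^T *m N *m (x - c)) 0 0 =
  (x^T *m N *m x) 0 0 + ((-2 *: (N *m c))^T *m x) 0 0 + (c^T *m N *m c) 0 0.
Proof.
move=> N_sym.
have trE (P : 'M[R]_1) : P^T 0 0 = P 0 0 by rewrite mxE.
have addE (P Q : 'M[R]_1) : (P + Q) 0 0 = P 0 0 + Q 0 0 by rewrite mxE.
have oppE (P : 'M[R]_1) : (- P) 0 0 = - P 0 0 by rewrite mxE.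
have scaleE k (P : 'M[R]_1) : (k *: P) 0 0 = k * P 0 0 by rewrite mxE.
have cross : (x^T *m N *m c) 0 0 = (c^T *m N *m x) 0 0.
  by rewrite -trE !trmx_mul trmxK N_sym mulmxA.
rewrite [(x - c)^T]linearB !(mulmxBl, mulmxBr) [(-2 *: _)^T]linearZ /= -scalemxAl trmx_mul N_sym.
by rewrite !(addE, oppE, scaleE) cross; ring.
Qed.

Theorem corollary5p2 (R : realType) (n : nat) (A D : 'M[R]_n.+1)
    (c : 'cV[R]_n.+1) (r1 r2 : R)
    (v : 'I_n.+1 -> 'cV[R]_n.+1) (alpha : 'I_n.+1 -> R)
    (A_unit : A \in unitmx) (D_neq0 : D != 0)
    (r1_ge0 : 0 <= r1) (r2_ge0 : 0 <= r2)
    (eig_dec : (invmx A)^T *m D^T *m D *m invmx A =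
               \sum_(i < n.+1) alpha i *: (v i *m (v i)^T))
    (v_norm1 : forall i, norm2 (v i) = 1)
    (v_orth : forall i j, i != j -> (v i)^T *m v j = 0)
    (alpha_max : forall i, alpha i <= alpha ord_max) :
  let E2 := norm2_sublevel A c r1 in
  let F := norm2_sublevel D c r2 in
  let Rm := \sum_(i < n.+1 | i != ord_max)
              (1 - alpha i / alpha ord_max) *: (v i *m (v i)^T) in
  let N := A^T *m Rm *m A in
  let a := - 2 *: (A^T *m Rm *m A *m c) in
  let f := (c^T *m A^T *m Rm *m A *m c) 0 0 + r2 / alpha ord_max - r1 in
  convex_hull (E2 `\` interior F) =
  [set x | norm2 (A *m (x - c)) ^+ 2 <= r1 /\
           (x^T *m N *m x) 0 0 + (a^T *m x) 0 0 + f <= 0].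
Proof.
move=> E2 F Rm N a f.
pose an := alpha ord_max.
pose z i (x : 'cV[R]_n.+1) := ((v i)^T *m (A *m (x - c))) 0 0.
have E2z x : norm2 (A *m (x - c)) ^+ 2 = \sum_i 1 * z i x ^+ 2.
  rewrite -(quadform_spectral xpredT (fun=> 1) v).
  under [X in _ *m X *m _]eq_bigr do rewrite scale1r.
  by rewrite orthonormal_resolution // mulmx1 norm2_sqr.
have Fz x : norm2 (D *m (x - c)) ^+ 2 = \sum_i alpha i * z i x ^+ 2.
  rewrite -(quadform_spectral xpredT alpha v) -eig_dec norm2_sqr.
  have -> : D *m (x - c) = D *m invmx A *m (A *m (x - c)).
    by rewrite mulmxA mulmxKV.
  by rewrite !trmx_mul !mulmxA.
have Nz x : (x^T *m N *m x) 0 0 + (a^T *m x) 0 0 + f =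
    \sum_(i | i != ord_max) (1 - alpha i / an) * z i x ^+ 2 + r2 / an - r1.
  have Rm_sym : Rm^T = Rm.
    rewrite linear_sum; apply: eq_bigr => i _.
    by rewrite linearZ /= trmx_mul trmxK.
  have N_sym : N^T = N by rewrite !trmx_mul trmxK Rm_sym mulmxA.
  rewrite -(quadform_spectral (fun i => i != ord_max)) -/Rm.
  have -> : (A *m (x - c))^T *m Rm *m (A *m (x - c)) = (x - c)^T *m N *m (x - c).
    by rewrite trmx_mul !mulmxA.
  by rewrite quadform_shift // /f /a /N !mulmxA !addrA.
have z_affine i k x y :
    z i (k *: x + (1 - k) *: y) = k * z i x + (1 - k) * z i y.
  rewrite /z.
  have -> : k *: x + (1 - k) *: y - c = k *: (x - c) + (1 - k) *: (y - c).
    by apply/matrixP => p q; rewrite !mxE; ring.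
  by rewrite 2!mulmxDr -!scalemxAr [LHS]mxE; congr (_ + _); rewrite [LHS]mxE.
(* Since [A u = v_n], moving along [u] changes only the last coordinate, at unit speed. *)
pose u := invmx A *m v ord_max.
have z_line i x t : z i (x + t *: u) = z i x + t * (i == ord_max)%:R.
  rewrite /z addrAC 2!mulmxDr -!scalemxAr /u mulKVmx // [LHS]mxE; congr (_ + _).
  rewrite [LHS]mxE; congr (_ * _).
  have [->|ne] := eqVneq i ord_max; last by rewrite v_orth // mxE.
  by rewrite -[LHS]norm2_sqr v_norm1 expr1n.
have z_line_ne x t i : i != ord_max -> z i (x + t *: u) = z i x.
  by move=> /negPf i_neq; rewrite z_line i_neq mulr0 addr0.
have z_line_max x t : z ord_max (x + t *: u) = z ord_max x + t.
  by rewrite z_line eqxx mulr1.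
(* Otherwise every [alpha i] is nonpositive, so [D] kills every vector, contradicting [D != 0]. *)
have an_gt0 : 0 < an.
  rewrite ltNge; apply: contra_neqN D_neq0 => an_le0.
  have D0 (x : 'cV[R]_n.+1) : D *m x = 0.
    apply: norm2_sqr_le0; rewrite -[x](addrK c) Fz sumr_le0 // => i _.
    rewrite mulr_le0_ge0 ?sqr_ge0 //.
    exact: le_trans (alpha_max i) an_le0.
  apply/matrixP => i j; have /colP /(_ i) := D0 (delta_mx j 0).
  by rewrite -colE !mxE.
(* [G] and [H] are the parts of [|z|^2] and [q(z)] free of [z_n]; the quadratic constraint becomes
   [G - H / an <= r1 - r2 / an]. *)
pose G x := \sum_(i | i != ord_max) z i x ^+ 2.
pose H x := \sum_(i | i != ord_max) alpha i * z i x ^+ 2.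
have E2G x : norm2 (A *m (x - c)) ^+ 2 = z ord_max x ^+ 2 + G x.
  rewrite E2z (bigD1 ord_max) //= mul1r; congr (_ + _).
  by apply: eq_bigr => i _; rewrite mul1r.
have FH x : norm2 (D *m (x - c)) ^+ 2 = an * z ord_max x ^+ 2 + H x.
  by rewrite Fz (bigD1 ord_max).
have NGH x : \sum_(i | i != ord_max) (1 - alpha i / an) * z i x ^+ 2 =
    G x - H x / an.
  by rewrite mulr_suml -sumrB; apply: eq_bigr => i _; ring.
have G_line x t : G (x + t *: u) = G x.
  by apply: eq_bigr => i ne; rewrite z_line_ne.
have H_line x t : H (x + t *: u) = H x.
  by apply: eq_bigr => i ne; rewrite z_line_ne.
have intF : interior F = [set x | norm2 (D *m (x - c)) ^+ 2 < r2].
  apply: interior_sublevel; first exact: continuous_norm2_sqr.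
  (* With [e] the sign of [z_n] (either sign works at [0]), [(z_n + t e)^2] exceeds [z_n^2] for
     every [t > 0]. *)
  move=> x; pose e : R := if 0 <= z ord_max x then 1 else -1.
  exists (fun t => x + t *: (e *: u)); first exact: cvg_line.
  move=> t t0; rewrite scalerA !FH H_line z_line_max ltrD2r ltr_pM2l //.
  by rewrite /e; case: ifPn => [|/negP/negP]; rewrite -?ltNge => zx; nra.
rewrite intF; apply/seteqP; split.
  apply: smallest_sub => [/=|x /= [E2x /negP]]; last first.
    rewrite -leNgt => Fx; split=> //; move: Fx E2x.
    rewrite Nz NGH /E2 /norm2_sublevel /= FH E2G => Fx E2x.
    (* Dividing [q(z) >= r2] by [an] and subtracting from [z_n^2 + G <= r1] cancels [z_n^2]. *)
    have : r2 / an <= z ord_max x ^+ 2 + H x / an.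
      by rewrite ler_pdivrMr // mulrDl divfK ?gt_eqF // mulrC.
    by lra.
  have -> : [set x | norm2 (A *m (x - c)) ^+ 2 <= r1 /\
      (x^T *m N *m x) 0 0 + (a^T *m x) 0 0 + f <= 0] =
    [set x | \sum_i 1 * z i x ^+ 2 <= r1] `&`
    [set x | \sum_(i | i != ord_max) (1 - alpha i / an) * z i x ^+ 2
             <= r1 - r2 / an].
    apply/seteqP; split => x /=; rewrite E2z Nz => -[? ?]; split => //; lra.
  move=> x y k /set_mem [x1 x2] /set_mem [y1 y2]; apply/mem_set; split.
    apply/set_mem; apply: convex_sublevel_sum_sqr => //; exact: mem_set.
  apply/set_mem; apply: convex_sublevel_sum_sqr => //; try exact: mem_set.
  by move=> i _; rewrite subr_ge0 ler_pdivrMr // mul1r.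
move=> x /= [E2x]; rewrite Nz NGH => Nx; rewrite E2G in E2x.
(* The line through [x] along [u] meets the sphere [|z|^2 = r1] where [z_n] is [s] or [- s]. *)
pose s := Num.sqrt (r1 - G x).
have rG : 0 <= r1 - G x by have := sqr_ge0 (z ord_max x); lra.
have s2 : s ^+ 2 = r1 - G x by rewrite sqr_sqrtr.
have /andP[zs1 zs2] : - s <= z ord_max x <= s.
  by rewrite -ler_norml -sqrtr_sqr ler_wsqrtr //; lra.
have on_sphere t : (z ord_max x + t) ^+ 2 = s ^+ 2 ->
    (E2 `\` [set x | norm2 (D *m (x - c)) ^+ 2 < r2]) (x + t *: u).
  rewrite s2 => zt; split; rewrite /E2 /norm2_sublevel /=.
    by rewrite E2G z_line_max G_line zt subrK.
  apply/negP; rewrite -leNgt FH z_line_max H_line zt.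
  (* This is the quadratic constraint at [x]; multiplied by [an], it reads [q(z) >= r2] at the end
     point. *)
  have : r2 / an <= r1 - G x + H x / an by lra.
  by rewrite ler_pdivrMr // mulrDl divfK ?gt_eqF // mulrC.
(* These parameters bring [z_n] to [- s] and [s]; their signs follow from [- s <= z_n <= s]. *)
apply: (convex_hull_segment (w := u) (s := - s - z ord_max x)
                            (t := s - z ord_max x)); try lra.
  by apply: on_sphere; rewrite addrC subrK sqrrN.
by apply: on_sphere; rewrite addrC subrK.
Qed.
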